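(* Let $n\ge1$, let $A,B$ be real symmetric $n\times n$ matrices, $a,b\in\mathbb{R}^n$, $f(x)=\langle Ax,x\rangle+\langle a,x\rangle$, $g(x)=\langle Bx,x\rangle+\langle b,x\rangle$ and $F(x)=(f(x),g(x))$ for $x\in\mathbb{R}^n$. Then: (a) $F(\mathbb{R}^n)+\mathbb{R}_{++}d$ is convex for all nonzero directions $d\in\mathbb{R}^2$ except possibly at most two (directions being identified up to multiplication by a positive scalar); (b) $F(\mathbb{R}^n)+P$ is convex for every convex cone $P\subseteq\mathbb{R}^2$ with nonempty interior. Consequently, $F(\mathbb{R}^n)+\operatorname{int}P$ is also convex.
   Context: $\mathbb{R}_{++}=\,]0,+\infty[$ and $\mathbb{R}_{++}d=\{td: t>0\}$. A set $P$ is a cone if $tP\subseteq P$ for all $t\ge 0$ (so a nonempty cone contains $0$). $\operatorname{int}$ denotes the topological interior in $\mathbb{R}^2$. *)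

(* Defs.v *)
From HB Require Import structures.
From mathcomp Require Import all_boot all_order all_algebra.
From mathcomp Require Import all_classical all_reals all_analysis.
Import Order.TTheory GRing.Theory Num.Theory.
Import numFieldNormedType.Exports.

Set Implicit Arguments.
Unset Strict Implicit.
Unset Printing Implicit Defensive.

Local Open Scope classical_set_scope.
Local Open Scope ring_scope.

(* [R^o] carries the structure of [R] as a module over itself, so that the
   pair type is an R-vector space with componentwise operations; its topology
   is the product topology. *)
Definition plane (R : realType) : normedModType R := (R^o * R^o)%type.

Definition dotprod (R : realType) (n : nat) (u v : 'cV[R]_n) : R :=
  \sum_(i < n) u i 0 * v i 0.

Definition quadfun (R : realType) (n : nat) (A : 'M[R]_n) (a : 'cV[R]_n)
    (x : 'cV[R]_n) : R :=
  dotprod (A *m x) x + dotprod a x.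

Definition quadmap (R : realType) (n : nat) (A B : 'M[R]_n) (a b : 'cV[R]_n)
    (x : 'cV[R]_n) : plane R :=
  (quadfun A a x, quadfun B b x).

Definition set_sum (V : zmodType) (S T : set V) : set V :=
  [set x + y | x in S & y in T].

Definition open_ray (R : realType) (V : lmodType R) (d : V) : set V :=
  [set t *: d | t in [set t : R | 0 < t]].

Definition is_cone (R : realType) (V : lmodType R) (P : set V) : Prop :=
  forall (t : R) (x : V), 0 <= t -> P x -> P (t *: x).

(* Main.v *)
(* For a direction [d] put [K_d = d.2 A - d.1 B].  If [K_d != 0], every convex
   combination of [F x] and [F y] lies in [F z + R_+ d] for some [z].  Indeed
   [F] maps the line through [x] and [y] to a parabola, on which such a [z]
   exists unless the parabola opens along [- d]; in that case either the
   coordinate transversal to [d] is constant on the line, or moving the line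
   around shows that [F(R^n) + R_+ d] is the whole plane.  If [A = B = 0] the
   range of [F] is a linear subspace.  Otherwise [K_d = 0] confines [d] to a
   line through 0: this leaves at most two exceptional directions, and a cone
   with nonempty interior is not contained in that line. *)
Require Import Defs.
From HB Require Import structures.
From mathcomp Require Import all_boot all_order all_algebra.
From mathcomp Require Import all_classical all_reals all_analysis.
From mathcomp Require Import unstable ring lra.
Import Order.TTheory GRing.Theory Num.Theory.
Import numFieldNormedType.Exports.

Set Implicit Arguments.
Unset Strict Implicit.
Unset Printing Implicit Defensive.

Local Open Scope classical_set_scope.
Local Open Scope ring_scope.

(** * Inequalities for polynomials in one variable *)

(** For [r >= 1] the lower terms are at most [S * r ^+ 3]; the choice [r = 1 - S / c4] makes
    [c4 * r ^+ 4 + S * r ^+ 3] equal to [c4 * r ^+ 3]. *)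
Lemma exists_quartic_le0 (R : realFieldType) (c4 c3 c2 c1 c0 : R) : c4 < 0 ->
  exists2 r : R, 0 < r &
    c4 * r ^+ 4 + c3 * r ^+ 3 + c2 * r ^+ 2 + c1 * r + c0 <= 0.
Proof.
move=> c4lt0; pose S := `|c3| + `|c2| + `|c1| + `|c0|.
have S0 : 0 <= S by rewrite !addr_ge0.
pose r := 1 - S / c4.
have r1 : 1 <= r by rewrite lerDl oppr_ge0 mulr_ge0_le0// invr_le0 ltW.
have r0 : 0 < r by exact: lt_le_trans r1.
exists r => //.
have bnd (c : R) k : (k <= 3)%N -> c * r ^+ k <= `|c| * r ^+ 3.
  move=> k3; apply: (le_trans (ler_norm _)).
  rewrite normrM (ger0_norm (exprn_ge0 _ (ltW r0))) ler_wpM2l//.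
  exact: ler_weXn2l.
have b3 := bnd c3 _ (leqnn 3).
have b2 : c2 * r ^+ 2 <= _ := bnd c2 2%N isT.
have b1 : c1 * r ^+ 1 <= _ := bnd c1 1%N isT.
have b0 : c0 * r ^+ 0 <= _ := bnd c0 0%N isT.
have e4 : c4 * r ^+ 4 + S * r ^+ 3 = c4 * r ^+ 3.
  by rewrite /r; field; rewrite lt_eqF.
have n3 : c4 * r ^+ 3 <= 0 by rewrite nmulr_rle0// exprn_ge0// ltW.
rewrite expr1 in b1; rewrite expr0 mulr1 in b0.
by rewrite /S !mulrDl in e4; lra.
Qed.

(* When [k2 != 0] the level equation has two roots, separated by [q]; on them
   the second coordinate minus its target is a multiple of [t - q]. *)
Lemma parabola_below_chord (R : rcfType) (k0 k1 k2 m0 m1 m2 p q : R) :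
  0 <= p -> 0 <= q -> p + q = 1 -> (k2 = 0 -> 0 <= m2) ->
  exists t : R,
    k0 + t * k1 + t ^+ 2 * k2 = p * k0 + q * (k0 + k1 + k2) /\
    m0 + t * m1 + t ^+ 2 * m2 <= p * m0 + q * (m0 + m1 + m2).
Proof.
move=> p0 q0 pq1 km; have pE : p = 1 - q by lra.
have pq0 : 0 <= p * q by exact: mulr_ge0.
have [k20|k20] := eqVneq k2 0.
  exists q; subst k2; have {}km := km erefl; rewrite pE; split; first by ring.
  rewrite -subr_ge0 [leRHS](_ : _ = (p * q) * m2); first exact: mulr_ge0.
  by rewrite pE; ring.
(* With [t = q + s] the level equation reads [s ^+ 2 + c * s = p * q]. As [p * q >= 0], its roots
   have weakly opposite signs, so one of them makes [s * mu] nonpositive. *)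
pose c := k1 / k2 + 2 * q; pose D := c ^+ 2 + 4 * (p * q).
have D0 : 0 <= D by rewrite addr_ge0 ?sqr_ge0// mulr_ge0.
pose r := Num.sqrt D.
have r0 : 0 <= r by exact: sqrtr_ge0.
have rD : r ^+ 2 = D by exact: sqr_sqrtr.
have cr : `|c| <= r by rewrite -sqrtr_sqr ler_wsqrtr// lerDl mulr_ge0.
have [cr1 cr2] : - r <= c /\ c <= r by apply/andP; rewrite -ler_norml.
pose mu := m1 - m2 * k1 / k2.
have root s : s ^+ 2 + c * s = p * q -> s * mu <= 0 ->
    k0 + (q + s) * k1 + (q + s) ^+ 2 * k2 = p * k0 + q * (k0 + k1 + k2) /\
    m0 + (q + s) * m1 + (q + s) ^+ 2 * m2 <= p * m0 + q * (m0 + m1 + m2).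
  move=> sE smu.
  have {}sE : (q + s) ^+ 2 = q - s * (k1 / k2).
    have -> : (q + s) ^+ 2 = q ^+ 2 + 2 * q * s + (p * q - c * s).
      by rewrite -sE; ring.
    by rewrite pE /c; ring.
  rewrite sE; split; first by rewrite pE; field.
  by rewrite -subr_le0 [leLHS](_ : _ = s * mu)// pE /mu; field.
have [mu0|mu0] := leP 0 mu.
- exists (q + (- c - r) / 2); apply: root.
    have -> : ((- c - r) / 2) ^+ 2 + c * ((- c - r) / 2) =
      (r ^+ 2 - c ^+ 2) / 4 by field.
    by rewrite rD /D; field.
  by rewrite mulr_le0_ge0//; lra.
- exists (q + (- c + r) / 2); apply: root.
    have -> : ((- c + r) / 2) ^+ 2 + c * ((- c + r) / 2) =
      (r ^+ 2 - c ^+ 2) / 4 by field.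
    by rewrite rD /D; field.
  by rewrite mulr_ge0_le0//; lra.
Qed.

(** * Inner products and quadratic functions on lines and planes *)

Lemma dotprodDl (R : realType) n (u v w : 'cV[R]_n) :
  dotprod (u + v) w = dotprod u w + dotprod v w.
Proof.
by rewrite /dotprod -big_split; apply: eq_bigr => i _; rewrite mxE mulrDl.
Qed.

Lemma dotprodZl (R : realType) n c (u v : 'cV[R]_n) :
  dotprod (c *: u) v = c * dotprod u v.
Proof.
by rewrite /dotprod mulr_sumr; apply: eq_bigr => i _; rewrite mxE mulrA.
Qed.

Lemma dotprodC (R : realType) n (u v : 'cV[R]_n) : dotprod u v = dotprod v u.
Proof. by apply: eq_bigr => i _; rewrite mulrC. Qed.

Lemma dotprodDr (R : realType) n (u v w : 'cV[R]_n) :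
  dotprod u (v + w) = dotprod u v + dotprod u w.
Proof. by rewrite dotprodC dotprodDl !(dotprodC u). Qed.

Lemma dotprodZr (R : realType) n c (u v : 'cV[R]_n) :
  dotprod u (c *: v) = c * dotprod u v.
Proof. by rewrite dotprodC dotprodZl (dotprodC u). Qed.

Lemma dotprod_gt0 (R : realType) n (u : 'cV[R]_n) : u != 0 -> 0 < dotprod u u.
Proof.
move=> u0; rewrite lt_neqAle eq_sym sumr_ge0 ?andbT; last first.
  by move=> i _; rewrite -expr2 sqr_ge0.
apply: contra_neq u0 => /eqP; rewrite psumr_eq0; last first.
  by move=> i _; rewrite -expr2 sqr_ge0.
move=> /allP u0; apply/colP => i; rewrite mxE; apply/eqP.
by have := u0 i (mem_index_enum _); rewrite mulf_eq0 orbb.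
Qed.

Lemma dotprod_mulmx_sym (R : realType) n (M : 'M[R]_n) (u v : 'cV[R]_n) :
  M^T = M -> dotprod (M *m u) v = dotprod (M *m v) u.
Proof.
have dotE (x y : 'cV[R]_n) : dotprod x y = (x^T *m y) 0 0.
  by rewrite mxE; apply: eq_bigr => i _; rewrite mxE.
by move=> MT; rewrite dotE [RHS]dotprodC dotE trmx_mul MT mulmxA.
Qed.

(** Collected by powers of [t]: shifting the base point by [s *: e] changes the slope along [h] by a
    multiple of [s], which is how lines are moved later. *)
Lemma quadfun_plane (R : realType) n (M : 'M[R]_n) (m w e h : 'cV[R]_n) s t :
  M^T = M ->
  quadfun M m (w + s *: e + t *: h) =
    quadfun M m w + s * (2 * dotprod (M *m e) w + dotprod m e)
    + s ^+ 2 * dotprod (M *m e) e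
    + t * (2 * dotprod (M *m h) w + dotprod m h + 2 * s * dotprod (M *m h) e)
    + t ^+ 2 * dotprod (M *m h) h.
Proof.
move=> MT; rewrite /quadfun !mulmxDr -!scalemxAr.
rewrite !(dotprodDl, dotprodDr, dotprodZl, dotprodZr).
rewrite (dotprod_mulmx_sym w e)// (dotprod_mulmx_sym w h)//.
by rewrite (dotprod_mulmx_sym e h)//; ring.
Qed.

Lemma quadfun_line (R : realType) n (M : 'M[R]_n) (m w h : 'cV[R]_n) t :
  M^T = M ->
  quadfun M m (w + t *: h) =
    quadfun M m w + t * (2 * dotprod (M *m h) w + dotprod m h)
    + t ^+ 2 * dotprod (M *m h) h.
Proof.
by move=> MT; have := quadfun_plane m w 0 h 0 t MT; rewrite scale0r addr0 => ->;
  ring.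
Qed.

Lemma quadfun_lincomb (R : realType) n (A B : 'M[R]_n) (a b x : 'cV[R]_n) p q :
  quadfun (p *: A + q *: B) (p *: a + q *: b) x =
    p * quadfun A a x + q * quadfun B b x.
Proof.
rewrite /quadfun mulmxDl -!scalemxAl !(dotprodDl, dotprodZl); ring.
Qed.

(** * Values of one quadratic function on the level sets of another *)

(** If the form vanished identically, polarising it at [M *m h] and [h] would give [M *m h] norm
    zero for every [h]. *)
Lemma symmetric_nonisotropic (R : realType) n (M : 'M[R]_n) :
  M^T = M -> M != 0 -> exists e, dotprod (M *m e) e != 0.
Proof.
move=> MT M0; apply: contrapT => /forallNP iso; case/eqP: M0.
have {}iso e : dotprod (M *m e) e = 0 by apply/eqP/negPn/negP/iso.
apply/matrixP => i j; rewrite mxE.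
have Mh (h : 'cV[R]_n) : M *m h = 0.
  apply/eqP/negPn/negP => /dotprod_gt0; set e := M *m h.
  have := iso (e + h); rewrite mulmxDr !(dotprodDl, dotprodDr) !iso.
  by rewrite (dotprod_mulmx_sym e h)// -/e; lra.
by have := Mh (delta_mx j 0); rewrite -colE => /colP/(_ i); rewrite !mxE.
Qed.

(* If the lines in direction [h] are parabolas opening downwards along the
   second axis, the points [z] of the level set [k = c] have [m] unbounded
   below: as [K != 0] (through [K h != 0] or a nonisotropic [e]) the line
   can be moved so that the parameter at which it meets [k = c] blows up. *)
Lemma level_unbounded_below (R : realType) n (K M : 'M[R]_n)
    (k m h w0 : 'cV[R]_n) (c y : R) :
  K^T = K -> M^T = M -> K != 0 ->
  dotprod (K *m h) h = 0 -> dotprod (M *m h) h < 0 ->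
  2 * dotprod (K *m h) w0 + dotprod k h != 0 ->
  exists z, quadfun K k z = c /\ quadfun M m z <= y.
Proof.
move=> KT MT K0 Khh Mhh sig0.
have [Kh0|Kh0] := eqVneq (K *m h) 0.
- have dot0 x : dotprod (K *m h) x = 0.
    by rewrite Kh0 -(scale0r 0) dotprodZl mul0r.
  have {}sig0 : dotprod k h != 0 by rewrite dot0 mulr0 add0r in sig0.
  have [e Kee] := symmetric_nonisotropic KT K0.
  set sg := dotprod k h in sig0; set kap := dotprod _ _ in Kee.
  set m2 := dotprod _ _ in Mhh.
  (* [t s] solves the level equation at [s *: e + t s *: h]. Since [al != 0], the second function is
     there a quartic in [s] with leading coefficient [m2 * al ^+ 2 < 0]. *)
  pose al := - kap / sg; pose be := - dotprod k e / sg; pose ga := c / sg.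
  pose t s := al * s ^+ 2 + be * s + ga.
  pose n1 := dotprod m e; pose n2 := dotprod (M *m e) e.
  pose l0 := dotprod m h; pose l1 := 2 * dotprod (M *m h) e.
  have [|s s0 sle] := exists_quartic_le0 (c4 := m2 * al ^+ 2)
    (m2 * (2 * al * be) + al * l1)
    (m2 * (be ^+ 2 + 2 * al * ga) + be * l1 + al * l0 + n2)
    (m2 * (2 * be * ga) + ga * l1 + be * l0 + n1)
    (m2 * ga ^+ 2 + ga * l0 - y) _.
    by rewrite nmulr_rlt0// exprn_even_gt0//= mulf_neq0 ?oppr_eq0 ?invr_eq0.
  exists (0 + s *: e + t s *: h); rewrite !quadfun_plane//.
  have q0 N l : quadfun N l (0 : 'cV[R]_n) = 0.
    by rewrite /quadfun mulmx0 -(scale0r 0) !dotprodZr !mul0r addr0.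
  have d0 (u : 'cV[R]_n) : dotprod u 0 = 0.
    by rewrite -(scale0r 0) dotprodZr mul0r.
  rewrite !q0 !d0 !dot0; split.
    by rewrite -/sg -/kap /t /al /be /ga; field.
  rewrite -subr_le0; apply: le_trans sle; rewrite le_eqVlt; apply/orP; left.
  by apply/eqP; rewrite -/m2 -/n1 -/n2 -/l0 /t /l1; ring.
- set e := K *m h in Kh0.
  have tau0 : 0 < 2 * dotprod e e by rewrite mulr_gt0// dotprod_gt0.
  set tau := 2 * dotprod e e in tau0.
  have tau_neq0 : tau != 0 by rewrite gt_eqF.
  (* At [w] the slope of the first function along [h] vanishes; at [w + s *: e] it is [s * tau]. *)
  pose w := (- dotprod k h / tau) *: e.
  have sigw : 2 * dotprod e w + dotprod k h = 0.
    rewrite /w dotprodZr; have -> : dotprod e e = tau / 2 by rewrite /tau; field.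
    by field.
  set m2 := dotprod _ _ in Mhh.
  pose l0 := 2 * dotprod (M *m h) w + dotprod m h.
  have [kw|kw] := eqVneq (quadfun K k w) c.
    (* The line through [w] along [h] lies in the level set; the parameter [t ^+ 2] turns the
       quadratic on it into a quartic. *)
    have [t t0 tle] := exists_quartic_le0 (c4 := m2) 0 l0 0
      (quadfun M m w - y) Mhh.
    exists (w + t ^+ 2 *: h); rewrite !quadfun_line// -/e sigw Khh kw; split.
      by ring.
    rewrite -subr_le0; apply: le_trans tle; rewrite le_eqVlt; apply/orP; left.
    by apply/eqP; rewrite -/m2 -/l0; ring.
  pose k1 := 2 * dotprod (K *m e) w + dotprod k e.
  pose k2 := dotprod (K *m e) e.
  (* From the base point [w + r^-1 *: e] the level set is met at parameter [al * r + be + ga / r],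
     with [al != 0]. Multiplying the required inequality by [r ^+ 2] makes it quartic in [r]. *)
  pose al := (c - quadfun K k w) / tau; pose be := - k1 / tau.
  pose ga := - k2 / tau.
  pose n1 := 2 * dotprod (M *m e) w + dotprod m e.
  pose n2 := dotprod (M *m e) e; pose l1 := 2 * dotprod (M *m h) e.
  have [|r r0 rle] := exists_quartic_le0 (c4 := m2 * al ^+ 2)
    (m2 * (2 * al * be) + al * l0)
    (m2 * (be ^+ 2 + 2 * al * ga) + be * l0 + al * l1 + (quadfun M m w - y))
    (m2 * (2 * be * ga) + ga * l0 + be * l1 + n1)
    (m2 * ga ^+ 2 + ga * l1 + n2) _.
    rewrite nmulr_rlt0// exprn_even_gt0//= mulf_neq0 ?invr_eq0//.
    by rewrite subr_eq0 eq_sym.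
  have rn0 : r != 0 by rewrite gt_eqF.
  exists (w + r^-1 *: e + (al * r + be + ga / r) *: h).
  rewrite !quadfun_plane// -/e sigw Khh -/k1 -/k2 -/n1 -/n2 -/l0 -/m2; split.
    have -> : dotprod e e = tau / 2 by rewrite /tau; field.
    by rewrite /al /be /ga; field; rewrite tau_neq0 rn0.
  have -> : 2 * r^-1 * dotprod (M *m h) e = l1 / r by rewrite /l1; ring.
  rewrite -subr_le0 -(pmulr_rle0 _ (exprn_gt0 2 r0)).
  apply: le_trans rle; rewrite le_eqVlt; apply/orP; left.
  by apply/eqP; field.
Qed.

(** This is the chord property in coordinates adapted to a direction [d]: [K] will be the
    transversal combination of [A] and [B], and [M] the one along [d]. *)
Lemma quadfun_pair_below_chord (R : realType) n (K M : 'M[R]_n)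
    (k m x y : 'cV[R]_n) (p q : R) :
  K^T = K -> M^T = M -> K != 0 -> 0 <= p -> 0 <= q -> p + q = 1 ->
  exists z, quadfun K k z = p * quadfun K k x + q * quadfun K k y /\
    quadfun M m z <= p * quadfun M m x + q * quadfun M m y.
Proof.
move=> KT MT K0 p0 q0 pq1; pose h := y - x.
have yE : y = x + 1 *: h by rewrite scale1r addrC subrK.
rewrite yE !(quadfun_line _ x)// !expr1n !mul1r.
set k1 := _ + dotprod k h; set m1 := _ + dotprod m h.
set k2 := dotprod (K *m h) h; set m2 := dotprod (M *m h) h.
have [|bad] := pselect (k2 = 0 -> 0 <= m2).
  case/(parabola_below_chord (quadfun K k x) k1 (quadfun M m x) m1 p0 q0 pq1).
  by move=> t tP; exists (x + t *: h); rewrite !quadfun_line.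
have [k20 m20] : k2 = 0 /\ m2 < 0.
  by move/not_implyP : bad => [-> /negP]; rewrite -ltNge.
have [k10|k10] := eqVneq k1 0; last exact: level_unbounded_below k10.
(* Here the first function is constant on the line, while the second tends to minus infinity. *)
have [t t0 tle] := exists_quartic_le0 (c4 := m2) 0 m1 0
  (quadfun M m x - (p * quadfun M m x + q * (quadfun M m x + m1 + m2))) m20.
exists (x + t ^+ 2 *: h); rewrite !quadfun_line// -/k1 -/k2 -/m1 -/m2 k10 k20.
split; first by rewrite -(addrK q p) pq1; ring.
rewrite -subr_le0; apply: le_trans tle; rewrite le_eqVlt; apply/orP; left.
by apply/eqP; ring.
Qed.

(** * Convexity, cones and interiors *)

Lemma convex_setP (R : realType) (V : lmodType R) (S : set V) :
  convex_set S <-> forall (x y : V) (p q : R), 0 <= p -> 0 <= q -> p + q = 1 ->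
    S x -> S y -> S (p *: x + q *: y).
Proof.
split=> [cS x y p q p0 q0 pq1 Sx Sy|cS x y l].
- have p1 : p <= 1 by rewrite -pq1 lerDl.
  have := cS x y (Itv01 p0 p1); rewrite !inE => /(_ Sx Sy).
  by rewrite /conv /= (_ : onem p = q)// /onem -pq1 addrC addKr.
- rewrite !inE => Sx Sy; apply: cS => //=; last exact: add_onemK.
  exact: onem_ge0.
Qed.

(** The chord defect lies in [D] and is absorbed by [T]. Keeping the two sets apart lets an open ray
    absorb a closed one, and the interior of a cone absorb the cone. *)
Lemma convex_range_sum (R : realType) (U : Type) (V : lmodType R)
    (F : U -> V) (D T : set V) :
  (forall x y (p q : R), 0 <= p -> 0 <= q -> p + q = 1 ->
     exists z, D (p *: F x + q *: F y - F z)) ->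
  convex_set T -> (forall u t, D u -> T t -> T (u + t)) ->
  convex_set (set_sum (range F) T).
Proof.
move=> chord /convex_setP cT DT; apply/convex_setP => _ _ p q p0 q0 pq1
  [_ [x _ <-]] [s Ts <-] [_ [y _ <-]] [t Tt <-].
have [z Dz] := chord x y p q p0 q0 pq1.
exists (F z); first by exists z.
exists ((p *: F x + q *: F y - F z) + (p *: s + q *: t)).
  by apply: DT => //; exact: cT.
by rewrite addrA (addrC (F z)) subrK !scalerDr addrACA.
Qed.

Lemma convex_cone_add (R : realType) (V : lmodType R) (P : set V) (u v : V) :
  is_cone P -> convex_set P -> P u -> P v -> P (u + v).
Proof.
move=> coneP /convex_setP cP Pu Pv.
have -> : u + v = 2 *: ((2^-1 : R) *: u + (2^-1 : R) *: v).
  by rewrite -scalerDr scalerA divff ?scale1r.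
by apply: coneP => //; apply: cP => //; field.
Qed.

(** Translation by [- u] is continuous, so every point near [u + v] is [u] plus a point of [P]. *)
Lemma cone_interior_add (R : realType) (V : normedModType R) (P : set V)
    (u v : V) :
  is_cone P -> convex_set P -> P u -> interior P v -> interior P (u + v).
Proof.
move=> coneP cP Pu Pv; rewrite /interior /=.
have shift : y - u @[y --> u + v] --> v.
  by rewrite -[X in _ --> X](addKr u) [X in _ --> X]addrC;
    apply: cvgB; [exact: cvg_id|exact: cvg_cst].
have : \forall y \near u + v, P (y - u) by exact: shift Pv.
apply: filterS => y /= Py.
by rewrite -(subrK u y) addrC; exact: convex_cone_add.
Qed.

(** For [q != 0] dilation by [q] carries neighbourhoods of [y] to neighbourhoods of [q *: y], which
    is thus interior; adding [p *: x] keeps it so. *)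
Lemma interior_cone_convex (R : realType) (V : normedModType R) (P : set V) :
  is_cone P -> convex_set P -> convex_set (interior P).
Proof.
move=> coneP cP; apply/convex_setP => x y p q p0 q0 pq1 Px Py.
have [q00|qn0] := eqVneq q 0.
  by move: pq1; rewrite q00 addr0 => ->; rewrite scale1r scale0r addr0.
apply: cone_interior_add => //; first exact: coneP p0 (interior_subset Px).
have := nbhsZ qn0 Py; apply: filterS => _ [z Pz <-]; exact: coneP.
Qed.

Lemma interior_segment (R : realType) (V : normedModType R) (P : set V)
    (u e : V) :
  interior P u -> exists2 t : R, 0 < t & P (u + t *: e).
Proof.
move=> Pu; have seg : u + t *: e @[t --> (0 : R)^'+] --> u.
  rewrite -[X in _ --> X]addr0 -(scale0r e).
  apply: cvgD; first exact: cvg_cst.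
  by apply: cvgZr_tmp; apply: cvg_at_right_filter; exact: cvg_id.
near (0 : R)^'+ => t; exists t; first by near: t; exact: nbhs_right_gt.
by near: t; exact: seg.
Unshelve. all: by end_near. Qed.

(** * Directions and the pencil spanned by [A] and [B] *)

Lemma quadmap_chord (R : realType) n (A B : 'M[R]_n) (a b : 'cV[R]_n)
    (d : plane R) :
  A^T = A -> B^T = B -> d.2 *: A - d.1 *: B != 0 \/ A = 0 /\ B = 0 ->
  forall x y (p q : R), 0 <= p -> 0 <= q -> p + q = 1 ->
  exists z, [set t *: d | t in [set t : R | 0 <= t]]
    (p *: quadmap A B a b x + q *: quadmap A B a b y - quadmap A B a b z).
Proof.
move=> AT BT AB x y p q p0 q0 pq1; case: AB => [K0|[-> ->]]; last first.
  exists (p *: x + q *: y), 0 => //=; rewrite scale0r /quadmap /quadfun.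
  rewrite !mul0mx !dotprodDr !dotprodZr.
  have d0 u : dotprod (0 : 'cV[R]_n) u = 0.
    by rewrite -(scale0r 0) dotprodZl mul0r.
  by rewrite !d0; congr (_, _) => /=; rewrite /GRing.scale/=; ring.
case: d K0 => d1 d2 /= K0; rewrite -scaleNr in K0.
have symD (c c' : R) : (c *: A + c' *: B)^T = c *: A + c' *: B.
  by rewrite linearD !linearZ /= AT BT.
have [z [zk zm]] := quadfun_pair_below_chord (d2 *: a + (- d1) *: b)
  (d1 *: a + d2 *: b) x y (symD _ _) (symD d1 d2) K0 p0 q0 pq1.
rewrite !quadfun_lincomb in zk zm.
have N0 : 0 < d1 ^+ 2 + d2 ^+ 2.
  rewrite lt_neqAle eq_sym addr_ge0 ?sqr_ge0// andbT.
  rewrite paddr_eq0 ?sqr_ge0// !sqrf_eq0; apply: contra_neqN K0.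
  by move=> /andP[/eqP-> /eqP->]; rewrite oppr0 !scale0r addr0.
set df := p * quadfun A a x + q * quadfun A a y - quadfun A a z.
set dg := p * quadfun B b x + q * quadfun B b y - quadfun B b z.
have dfg : d2 * df = d1 * dg by apply/eqP; rewrite -subr_eq0 /df /dg;
  apply/eqP; lra.
(* By [dfg] the defect [(df, dg)] is parallel to [d], so it equals its projection on [d]; the
   coefficient is nonnegative by [zm]. *)
exists z, ((d1 * df + d2 * dg) / (d1 ^+ 2 + d2 ^+ 2)).
  by rewrite /= divr_ge0 ?(ltW N0)// /df /dg; lra.
congr (_, _); rewrite /= /GRing.scale /=.
  rewrite mulrAC; apply: (canLR (mulfK _)); first by rewrite gt_eqF.
  have -> : (d1 * df + d2 * dg) * d1 = d1 ^+ 2 * df + d2 * (d1 * dg) by ring.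
  by rewrite -dfg -/df; ring.
rewrite mulrAC; apply: (canLR (mulfK _)); first by rewrite gt_eqF.
have -> : (d1 * df + d2 * dg) * d2 = d2 ^+ 2 * dg + d1 * (d2 * df) by ring.
by rewrite dfg -/dg; ring.
Qed.

Lemma open_ray_convex (R : realType) (V : lmodType R) (d : V) :
  convex_set (open_ray d).
Proof.
apply/convex_setP => _ _ p q p0 q0 pq1 [s s0 <-] [t t0 <-].
exists (p * s + q * t); last by rewrite scalerDl !scalerA.
rewrite /= in s0 t0 *; have [p00|pn0] := eqVneq p 0.
  by move: pq1; rewrite p00 add0r => ->; rewrite mul0r add0r mul1r.
by rewrite ltr_wpDr ?mulr_ge0 ?(ltW t0)// mulr_gt0// lt_neqAle eq_sym pn0.
Qed.

(** Eliminating between the two relations shows that the determinant of [d] and [d0] annihilates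
    both [A] and [B]. *)
Lemma pencil_kernel_collinear (R : realType) n (A B : 'M[R]_n)
    (d0 d : plane R) :
  d0 != 0 -> d0.2 *: A - d0.1 *: B = 0 -> d.2 *: A - d.1 *: B = 0 ->
  (exists t : R, d = t *: d0) \/ A = 0 /\ B = 0.
Proof.
move=> d0n0 Kd0 Kd.
have detA : (d.1 * d0.2 - d0.1 * d.2) *: A = 0.
  rewrite (_ : _ *: A = d.1 *: (d0.2 *: A - d0.1 *: B)
                        - d0.1 *: (d.2 *: A - d.1 *: B)).
    by rewrite Kd Kd0 !scaler0 subrr.
  by apply/matrixP => i j; rewrite !mxE; ring.
have detB : (d.1 * d0.2 - d0.1 * d.2) *: B = 0.
  rewrite (_ : _ *: B = d.2 *: (d0.2 *: A - d0.1 *: B)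
                        - d0.2 *: (d.2 *: A - d.1 *: B)).
    by rewrite Kd Kd0 !scaler0 subrr.
  by apply/matrixP => i j; rewrite !mxE; ring.
have [det0|detn0] := eqVneq (d.1 * d0.2 - d0.1 * d.2) 0; last first.
  right; split; apply/eqP.
    by move/eqP : detA; rewrite scaler_eq0 (negbTE detn0).
  by move/eqP : detB; rewrite scaler_eq0 (negbTE detn0).
left.
have [d01|d01] := eqVneq d0.1 0.
  have d02 : d0.2 != 0.
    apply: contra_neq d0n0 => d02.
    by rewrite [d0]surjective_pairing d01 d02.
  exists (d.2 / d0.2); rewrite [LHS]surjective_pairing.
  congr (_, _); rewrite /= /GRing.scale /= ?divfK// d01 mulr0.
  move/eqP : det0; rewrite d01 mul0r subr0 mulf_eq0 (negbTE d02) orbF.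
  by move/eqP.
exists (d.1 / d0.1); rewrite [LHS]surjective_pairing.
congr (_, _); rewrite /= /GRing.scale /= ?divfK// mulrAC.
apply: (canRL (mulfK d01)); rewrite [LHS]mulrC.
by move/eqP : det0; rewrite subr_eq0 => /eqP.
Qed.

(** * Sums with open rays, cones and their interiors *)

Theorem theorem4p17 (R : realType) (n : nat) (hn : (1 <= n)%N)
  (A B : 'M[R]_n) (hA : A \is symmetricmx) (hB : B \is symmetricmx)
  (a b : 'cV[R]_n) :
  (exists d1 d2 : plane R,
     [/\ d1 != 0, d2 != 0 &
       forall d : plane R, d != 0 -> ~ open_ray d1 d -> ~ open_ray d2 d ->
         convex_set (set_sum (range (quadmap A B a b)) (open_ray d))]) /\
  (forall P : set (plane R),
     is_cone P -> convex_set P -> interior P !=set0 ->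
     convex_set (set_sum (range (quadmap A B a b)) P) /\
     convex_set (set_sum (range (quadmap A B a b)) (interior P))).
Proof.
have symE (M : 'M[R]_n) : M \is symmetricmx -> M^T = M.
  by rewrite qualifE expr0 scale1r map_mx_id// => /eqP {2}->.
have {}hA := symE A hA; have {}hB := symE B hB.
split.
- have ray_convex (d : plane R) :
      d.2 *: A - d.1 *: B != 0 \/ A = 0 /\ B = 0 ->
      convex_set (set_sum (range (quadmap A B a b)) (open_ray d)).
    move=> AB; apply: convex_range_sum (quadmap_chord a b hA hB AB) _ _.
      exact: open_ray_convex.
    move=> _ _ [s s0 <-] [t t0 <-]; exists (s + t); last by rewrite scalerDl.
    by rewrite /= ltr_wpDl.
  have [[d0 [d0n0 Kd0]]|noK] :=
      pselect (exists d : plane R, d != 0 /\ d.2 *: A - d.1 *: B = 0).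
    (* Any other failing direction is a multiple of [d0]; the sign of the factor puts it on one of
       these two rays. *)
    exists d0, (- d0); split=> //; first by rewrite oppr_eq0.
    move=> d dn0 dd0 ddN0; apply: ray_convex.
    have [Kd|] := eqVneq (d.2 *: A - d.1 *: B) 0; last by left.
    have [[t dE]|] := pencil_kernel_collinear d0n0 Kd0 Kd; last by right.
    exfalso.
    have tn0 : t != 0 by apply: contra_neq dn0 => t0; rewrite dE t0 scale0r.
    have [t0|t0] := ltP 0 t; first by apply: dd0; exists t.
    apply: ddN0; exists (- t); last by rewrite scaleNr scalerN opprK.
    by rewrite /= oppr_gt0 lt_neqAle tn0.
  (* No direction is exceptional here, so any nonzero vector may be named. *)
  have i0 : ((1, 0) : plane R) != 0.
    by apply/eqP => -[] /eqP; rewrite oner_eq0.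
  exists (1, 0), (1, 0); split=> // d dn0 _ _; apply: ray_convex; left.
  by apply: contra_notN noK => /eqP Kd; exists d.
- move=> P coneP cP [u Pu].
  have [d Pd AB] :
      exists2 d, P d & d.2 *: A - d.1 *: B != 0 \/ A = 0 /\ B = 0.
    apply: contrapT => /forall2NP noK.
    have noK0 d : P d -> d.2 *: A - d.1 *: B = 0.
      by move=> Pd; case: (noK d) => // /not_orP[/negP/negPn/eqP].
    have Ku := noK0 _ (interior_subset Pu).
    (* The matrix [d.2 *: A - d.1 *: B] is linear in [d]: vanishing at [u] and at its shifts along
       both axes, it forces [B = 0] and [A = 0], which is the other admissible case. *)
    have [s s0 Ps] := interior_segment ((1, 0) : plane R) Pu.
    have [t t0 Pt] := interior_segment ((0, 1) : plane R) Pu.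
    have /eqP sB : s *: B = 0.
      rewrite -[RHS](subrr 0) -{1}Ku -(noK0 _ Ps).
      by apply/matrixP => i j; rewrite !mxE /= /GRing.scale /=; ring.
    have /eqP tA : t *: A = 0.
      rewrite -[RHS](subrr 0) -{1}(noK0 _ Pt) -{1}Ku.
      by apply/matrixP => i j; rewrite !mxE /= /GRing.scale /=; ring.
    move: sB tA; rewrite !scaler_eq0 !gt_eqF//= => /eqP B0 /eqP A0.
    by case: (noK u) => [[]|[]]; [exact: interior_subset|right].
  have chord x y (p q : R) : 0 <= p -> 0 <= q -> p + q = 1 ->
      exists z, P (p *: quadmap A B a b x + q *: quadmap A B a b y
                   - quadmap A B a b z).
    move=> p0 q0 pq1.
    have [z [t t0 tE]] := quadmap_chord a b hA hB AB x y p0 q0 pq1.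
    by exists z; rewrite -tE; exact: coneP.
  split; apply: convex_range_sum chord _ _ => //.
  + by move=> v w; exact: convex_cone_add.
  + exact: interior_cone_convex.
  + by move=> v w; exact: cone_interior_add.
Qed.
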